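(* The residue modulo $5$ of the $5$-core crank divides the partitions enumerated by $p_i(5n+4)$, $i=0,2$, into five equal classes. That is, for every integer $n\ge0$, every $i\in\{0,2\}$ and every $k\in\{0,1,2,3,4\}$, the number of partitions $\pi$ of $5n+4$ with $\mathrm{srank}(\pi)\equiv i\pmod 4$ and $c_5(\pi)\equiv k\pmod 5$ equals $\tfrac15\,p_i(5n+4)$.
   Context: Stanley rank: for a partition $\pi$ with conjugate $\pi'$, $\mathrm{srank}(\pi)=\mathcal O(\pi)-\mathcal O(\pi')$, where $\mathcal O(\pi)$ is the number of odd parts of $\pi$ (counted with multiplicity). It is always even. For $i\in\{0,2\}$, $p_i(n)$ denotes the number of partitions $\pi$ of $n$ with $\mathrm{srank}(\pi)\equiv i\pmod 4$. The $5$-core crank $c_5(\pi)$ of a partition $\pi$ with $|\pi|\equiv4\pmod5$ is defined as follows. A partition is a $5$-core if it has no rim hooks of length $5$; the $5$-core $\pi_{5\text{-core}}$ of $\pi$ is the $5$-core obtained from $\pi$ by successively removing rim hooks of length $5$ until none remain (it does not depend on the choices made). Label the cell in the $i$-th row and $j$-th column (rows and columns numbered from $1$) of the Young diagram of $\pi_{5\text{-core}}$ by the least nonnegative integer congruent to $j-i$ modulo $5$, and for $0\le i\le4$ let $r_i$ be the number of cells of $\pi_{5\text{-core}}$ labelled $i$. The $n$-vector of $\pi_{5\text{-core}}$ is $$(n_0,n_1,n_2,n_3,n_4)=(r_0-r_1,\;r_1-r_2,\;r_2-r_3,\;r_3-r_4,\;r_4-r_0).$$ Since $|\pi|\equiv4\pmod5$,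 there is a unique integer vector $\vec\alpha=(\alpha_0,\alpha_1,\alpha_2,\alpha_3,\alpha_4)\in\mathbb Z^5$ with $\alpha_0+\alpha_1+\alpha_2+\alpha_3+\alpha_4=1$ and $$n_0=\alpha_0+\alpha_4,\quad n_1=-\alpha_0+\alpha_1+\alpha_4,\quad n_2=-\alpha_1+\alpha_2,\quad n_3=-\alpha_2+\alpha_3-\alpha_4,\quad n_4=-\alpha_3-\alpha_4.$$ Then $$c_5(\pi)=1+\sum_{i=0}^4 i\,\alpha_i\equiv 2(1+n_0-n_1-n_2+n_3)\equiv 2+\sum_{i=-2}^{2} i\,r_{2-i}\pmod5.$$ *)

(* Defs.v *)
From HB Require Import structures.
From mathcomp Require Import all_boot all_order all_algebra.
From mathcomp Require Import zify ring.

Set Implicit Arguments.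
Unset Strict Implicit.
Unset Printing Implicit Defensive.

Import GRing.Theory Num.Theory.

Local Open Scope nat_scope.

(* The parts are listed in weakly decreasing order, without zeros. *)
Definition is_part (s : seq nat) : bool := sorted geq s && (0 \notin s).

Definition is_part_of (n : nat) (s : seq nat) : bool :=
  is_part s && (sumn s == n).

Record intpartn (n : nat) := IntPartn { pval :> seq nat; pvalP : is_part_of n pval }.

HB.instance Definition _ n := [isSub for @pval n].
HB.instance Definition _ n := [Countable of intpartn n by <:].

(* A partition of n has at most n parts, each at most n. *)
Definition intpartn_enum (n : nat) : seq (intpartn n) :=
  undup (pmap insub
    [seq [seq i <- [seq val i | i <- val t] | i != 0]
      | t <- enum {: n.-tuple 'I_n.+1}]).

Lemma size_le_sumn s : 0 \notin s -> size s <= sumn s.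
Proof.
elim: s => //= x s IHs; rewrite inE negb_or eq_sym => /andP[x0 /IHs].
by rewrite -lt0n in x0; lia.
Qed.

Lemma mem_le_sumn s x : x \in s -> x <= sumn s.
Proof. by elim: s => //= y s IHs; rewrite inE => /orP[/eqP->|/IHs]; lia. Qed.

Lemma intpartn_enumP n : Finite.axiom (intpartn_enum n).
Proof.
apply: Finite.uniq_enumP; first exact: undup_uniq.
move=> p; rewrite mem_undup mem_pmap_sub /=.
have /andP[/andP[_ s0] /eqP sn] := pvalP p.
set s := pval p in s0 sn *.
pose u := s ++ nseq (n - size s) 0.
have le_sn : size s <= n by rewrite -sn; exact: size_le_sumn.
have szu : size [seq inord i : 'I_n.+1 | i <- u] == n.
  by rewrite size_map size_cat size_nseq subnKC.
have valu : [seq val i | i <- [seq inord i : 'I_n.+1 | i <- u]] = u.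
  rewrite -map_comp -[RHS]map_id; apply/eq_in_map => i.
  rewrite mem_cat /= => /orP[/mem_le_sumn|]; last first.
    by rewrite mem_nseq => /andP[_ /eqP->]; rewrite inordK.
  by rewrite sn => le_in; rewrite inordK.
apply/mapP; exists (Tuple szu); first by rewrite mem_enum.
rewrite valu filter_cat.
have -> : [seq i <- nseq (n - size s) 0 | i != 0] = [::].
  by elim: (n - size s).
rewrite cats0; apply/esym/all_filterP/allP => i si.
by apply: contraNneq s0 => <-.
Qed.

HB.instance Definition _ n := isFinite.Build (intpartn n) (@intpartn_enumP n).

(* Counting positions from 0, the j-th part of the conjugate is the number of
   parts of s exceeding j. *)
Definition conjp (s : seq nat) : seq nat :=
  mkseq (fun j => count (fun x => j < x) s) (head 0 s).

Definition oddparts (s : seq nat) : nat := count odd s.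

Definition srank (s : seq nat) : int :=
  ((oddparts s)%:Z - (oddparts (conjp s))%:Z)%R.

(* Rows and columns are numbered from 0; only the difference j - i is used. *)
Definition cells (s : seq nat) : seq (nat * nat) :=
  [seq (i, j) | i <- iota 0 (size s), j <- iota 0 (nth 0 s i)].

Definition adjacent (c d : nat * nat) : bool :=
  (c.1 == d.1) && ((c.2.+1 == d.2) || (d.2.+1 == c.2))
  || (c.2 == d.2) && ((c.1.+1 == d.1) || (d.1.+1 == c.1)).

Definition connected_cells (C : seq (nat * nat)) : bool :=
  [forall c : seq_sub C, forall d : seq_sub C,
     connect (fun a b : seq_sub C => adjacent (val a) (val b)) c d].

Definition skew_cells (s m : seq nat) : seq (nat * nat) :=
  [seq c <- cells s | c \notin cells m].

(* A cell (i, j) is on the rim when (i+1, j+1) is not in the diagram. *)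
Definition in_rim (s : seq nat) (c : nat * nat) : bool :=
  (c \in cells s) && ((c.1.+1, c.2.+1) \notin cells s).

(* m is obtained from s by removing a rim hook of length t. *)
Definition rim_hook_removal (t : nat) (s m : seq nat) : bool :=
  [&& is_part m, all (mem (cells s)) (cells m), size (skew_cells s m) == t,
      all (in_rim s) (skew_cells s m) & connected_cells (skew_cells s m)].

Definition is_core (t : nat) (s : seq nat) : Prop :=
  forall m, ~~ rim_hook_removal t s m.

Definition remove_hook (t : nat) (s : seq nat) : seq nat :=
  if [pick m : intpartn (sumn s - t) | rim_hook_removal t s m] is Some m
  then pval m else s.

(* For t > 0 the process stops after at most sumn s removals; see
   core_is_core and core_reachable. *)
Definition core (t : nat) (s : seq nat) : seq nat :=
  iter (sumn s) (remove_hook t) s.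

Definition rcount (s : seq nat) (i : nat) : nat :=
  count (fun c => ((c.2%:Z - c.1%:Z)%R %% 5)%Z == i) (cells s).

Definition nvec (s : seq nat) (i : nat) : int :=
  ((rcount s i)%:Z - (rcount s (i.+1 %% 5))%:Z)%R.

Definition alpha_spec (n : nat -> int) (a : 5.-tuple int) : bool :=
  [&& a`_0 + a`_1 + a`_2 + a`_3 + a`_4 == 1,
      n 0%N == a`_0 + a`_4,
      n 1%N == - a`_0 + a`_1 + a`_4,
      n 2%N == - a`_1 + a`_2,
      n 3%N == - a`_2 + a`_3 - a`_4 &
      n 4%N == - a`_3 - a`_4]%R.

Lemma size_cells s : size (cells s) = sumn s.
Proof.
rewrite /cells size_allpairs_dep.
rewrite (eq_map (g := nth 0 s)); last by move=> i; rewrite size_iota.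
by rewrite map_nth_iota0 // take_size.
Qed.

Lemma cells_uniq s : uniq (cells s).
Proof.
apply: allpairs_uniq_dep => [|i _|[i j] [i' j'] _ _ /= [-> ->]] //;
  exact: iota_uniq.
Qed.

Lemma size_skew_cells s m : {subset cells m <= cells s} ->
  size (skew_cells s m) + sumn m = sumn s.
Proof.
move=> sub; rewrite -!size_cells /skew_cells size_filter addnC.
rewrite -(count_predC [in cells m] (cells s)); congr (_ + _).
rewrite -size_filter; apply/perm_size/uniq_perm.
- exact: cells_uniq.
- exact: filter_uniq (cells_uniq s).
by move=> c; rewrite mem_filter; apply/idP/andP => [cm|[]//]; split => //; exact: sub.
Qed.

Lemma rim_hook_removal_sumn t s m : rim_hook_removal t s m -> t + sumn m = sumn s.
Proof.
by case/and5P=> _ /allP sub /eqP <- _ _; rewrite size_skew_cells.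
Qed.

Lemma remove_hookP t s :
  rim_hook_removal t s (remove_hook t s)
  \/ is_core t s /\ remove_hook t s = s.
Proof.
rewrite /remove_hook; case: pickP => [m hm|no]; [by left | right].
split=> // m; apply/negP => hm.
have mP : is_part_of (sumn s - t) m.
  have := rim_hook_removal_sumn hm; case/and5P: hm => pm _ _ _ _ e.
  by rewrite /is_part_of pm -e addKn eqxx.
by have := no (IntPartn mP); rewrite /= hm.
Qed.

Lemma core_is_core t s : 0 < t -> is_core t (core t s).
Proof.
move=> t0; suff stop k s' : sumn s' <= k -> is_core t (iter k (remove_hook t) s').
  exact: stop.
elim: k s' => [|k IHk] {}s le_s.
  by move=> m /=; apply/negP => /rim_hook_removal_sumn; lia.
rewrite iterSr; case: (remove_hookP t s) => [/rim_hook_removal_sumn e|[cs e]].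
  by apply: IHk; lia.
have fix_s j : iter j (remove_hook t) s = s by elim: j => //= j ->.
by rewrite e fix_s.
Qed.

Lemma core_reachable t s : exists r : seq (seq nat),
  path (rim_hook_removal t) s r /\ last s r = core t s.
Proof.
rewrite /core; elim: (sumn s) => [|k [r [pr lr]]]; first by exists [::].
rewrite iterS -lr; case: (remove_hookP t (last s r)) => [h|[_ ->]].
  by exists (rcons r (remove_hook t (last s r))); rewrite rcons_path pr last_rcons.
by exists r.
Qed.

Lemma sumn_core t s : sumn (core t s) = sumn s %[mod t].
Proof.
have [r [pr <-]] := core_reachable t s.
elim: r s pr => //= m r IHr s /andP[/rim_hook_removal_sumn <- /IHr ->].
by rewrite modnDl.
Qed.

Lemma sum_rcount s :
  rcount s 0 + rcount s 1 + rcount s 2 + rcount s 3 + rcount s 4 = sumn s.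
Proof.
rewrite -size_cells /rcount; elim: (cells s) => //= c l <-.
set z := ((_ %% 5)%Z); have : (0 <= z)%R /\ (z < 5)%R by rewrite /z; lia.
by move: z => z; lia.
Qed.

Lemma alpha_unique n a b : alpha_spec n a -> alpha_spec n b -> a = b.
Proof.
case: a b => [[|a0 [|a1 [|a2 [|a3 [|a4 [|? ?]]]]]] //= sa].
case=> [[|b0 [|b1 [|b2 [|b3 [|b4 [|? ?]]]]]] //= sb].
rewrite /alpha_spec /=.
case/and5P=> /eqP ea /eqP e0 /eqP e1 /eqP e2 /andP[/eqP e3 /eqP e4].
case/and5P=> /eqP fa /eqP f0 /eqP f1 /eqP f2 /andP[/eqP f3 /eqP f4].
apply/val_inj => /=.
have E4 : a4 = b4 by lia.
have E0 : a0 = b0 by lia.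
have E1 : a1 = b1 by lia.
have E2 : a2 = b2 by lia.
have E3 : a3 = b3 by lia.
by congruence.
Qed.

Lemma alpha_exists n (p : intpartn (5 * n + 4)) :
  exists a, alpha_spec (nvec (core 5 p)) a.
Proof.
have /andP[_ /eqP sp] := pvalP p.
have := sumn_core 5 p; rewrite sp -sum_rcount.
rewrite /alpha_spec /nvec -[5 %% 5]/0 -[1 %% 5]/1 -[2 %% 5]/2 -[3 %% 5]/3 -[4 %% 5]/4.
move: (rcount _ 0) (rcount _ 1) (rcount _ 2) (rcount _ 3) (rcount _ 4).
move=> r0 r1 r2 r3 r4 e.
pose q := (r0 + r1 + r2 + r3 + r4) %/ 5.
have eq : r0 + r1 + r2 + r3 + r4 = 5 * q + 4 by rewrite /q; lia.
pose a4 := (r0%:Z - q%:Z - 1)%R.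
exists [tuple (r0%:Z - r1%:Z - a4)%R; (r0%:Z - r2%:Z - 2 * a4)%R;
  (r0%:Z - r3%:Z - 2 * a4)%R; (r0%:Z - r4%:Z - a4)%R; a4].
by rewrite /= /a4; apply/and5P; split; try (apply/andP; split); apply/eqP; lia.
Qed.

(* The unique solution alpha of the linear system; see alpha_unique. *)
Definition alpha n (p : intpartn (5 * n + 4)) : 5.-tuple int :=
  xchoose (alpha_exists p).

Definition c5 n (p : intpartn (5 * n + 4)) : int :=
  (1 + \sum_(i < 5) i%:Z * (alpha p)`_i)%R.

Definition p_ (i n : nat) : nat :=
  #|[set p : intpartn n | (srank p == i %[mod 4])%Z]|.

(* Main.v *)
Require Import Defs.
From HB Require Import structures.
From mathcomp Require Import all_boot all_order all_algebra.
From mathcomp Require Import zify ring.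

Set Implicit Arguments.
Unset Strict Implicit.
Unset Printing Implicit Defensive.

Import GRing.Theory Num.Theory.

Local Open Scope nat_scope.

(** The idea is to write a partition on a 5-abacus and to rotate the vector alpha
    cyclically.

    A rim hook of length 5 has exactly one cell in each residue class of contents
    modulo 5 ([rim_hook_count]), so a partition and its 5-core have the same
    n-vector ([nvec_core]), and the crank can be read off the partition itself.
    For a fixed large M, encode s by its M beads s_i + (M - i), i = 1..M, where
    the parts are padded with zeros. A sum over cells of a difference
    F (x + 1) - F x, with x the content up to a shift by M, telescopes along rows
    into a sum of F over the beads ([sum_beads]). This turns every statistic at
    hand into a bead sum:
    - the size is, up to a constant, the sum of the beads;
    - the entry n_i is, up to a constant, the number of beads in the class of i
      modulo 5, called runner i;
    - the Stanley rank is congruent modulo 4 to the size plus the number of odd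
      beads, up to a constant ([srank_beads]). Indeed it is the sum over the cells
      (i, j) of (-1)^j - (-1)^i, which is congruent to 1 - (-1)^(i+j).

    Let alpha' be alpha shifted by one place. As the entries of alpha add up to 1,
    the sum of i * alpha_i grows by 1 modulo 5 ([c5_rot]), so the partitions of each
    rank class are equidistributed as soon as alpha -> alpha' lifts to an injection
    that preserves size and rank. Modulo 2, n_i + i is the sum of two cyclically
    adjacent entries of alpha, and every adjacent pair arises from exactly one i.
    Hence the shift of alpha induces a permutation of the runners,
    0 -> 3 -> 2 -> 1 -> 4 -> 0, with n'_(next i) + next i = n_i + i modulo 2
    ([charge_parity]).
    The lift moves the beads of runner i rigidly to runner next i, by the number
    n'_(next i) - n_i of rows which changes the n-vector as required. By the
    congruence a bead keeps its parity, and the number of odd beads is unchanged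
    ([odd_twist]). The sum of the beads changes by half the variation of the
    quadratic form sum_i (5 n_i^2 + 2 i n_i), which is invariant under the cyclic
    shift of alpha ([energy_rot]). Thus the size is preserved, and the injections
    between the five crank classes, taken around the cycle, force equal
    cardinals. *)

(** * Cells and the Stanley rank *)

Lemma mem_cells s c : (c \in cells s) = (c.2 < nth 0 s c.1).
Proof.
case: c => i j /=; apply/allpairsPdep/idP => [[i' [j' [_]]]|lt_j].
  by rewrite mem_iota => lt_j [-> ->].
exists i, j; rewrite !mem_iota /= add0n lt_j; split=> //.
by rewrite ltnNge; apply: contraTN lt_j => ?; rewrite nth_default.
Qed.

Lemma big_cells_cons (V : nmodType) x s (f : nat * nat -> V) :
  (\sum_(c <- cells (x :: s)) f c =
   \sum_(j < x) f (0, nat_of_ord j) + \sum_(c <- cells s) f (c.1.+1, c.2))%R.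
Proof.
rewrite /cells !big_allpairs_dep /= big_cons /=; congr (_ + _)%R.
  by rewrite -{1}[x]subn0 big_mkord.
by rewrite -[1]/(1 + 0) iotaDl big_map.
Qed.

Lemma cells_pad s k : cells (s ++ nseq k 0) = cells s.
Proof.
rewrite /cells size_cat iotaD map_cat flatten_cat size_nseq add0n.
rewrite -[RHS]cats0; congr (_ ++ _).
  congr flatten; apply/eq_in_map => i; rewrite mem_iota => /andP[_ lt_i].
  by rewrite nth_cat lt_i.
apply: size0nil; rewrite size_flatten /shape -map_comp.
apply/eqP; rewrite sumnE big_map big_seq big1 // => i; rewrite mem_iota => /andP[ge_i _].
by rewrite /= size_map size_iota nth_cat ltnNge ge_i /= nth_nseq if_same.
Qed.

Lemma sum_sign n : (\sum_(j < n) (-1) ^+ j = (odd n)%:Z :> int)%R.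
Proof.
elim: n => [|n IHn]; first by rewrite big_ord0.
by rewrite big_ord_recr /= IHn -signr_odd; case: (odd n).
Qed.

Lemma oddparts_mkseq t m :
  ((oddparts (mkseq t m))%:Z = \sum_(j < m) (odd (t j))%:Z :> int)%R.
Proof.
elim: m => [|m IHm]; first by rewrite big_ord0.
by rewrite mkseqS /oddparts -cats1 count_cat PoszD IHm big_ord_recr /= addn0.
Qed.

(** A new first row lengthens each of its x columns by one, which flips the parity
    of every column. *)
Lemma oddparts_conjp_cons x s : is_part (x :: s) ->
  ((oddparts (conjp (x :: s)))%:Z = x%:Z - (oddparts (conjp s))%:Z :> int)%R.
Proof.
case/andP=> /= path_x _.
have geq_trans : transitive geq by move=> a b c /= le_ab le_ca; apply: leq_trans le_ab.
have le_x y : y \in s -> y <= x by move/(allP (order_path_min geq_trans path_x)).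
have le_hx : head 0 s <= x by case: (s) le_x => //= y s'; apply; rewrite mem_head.
have le_h y : y \in s -> y <= head 0 s.
  case: (s) path_x => //= z s' /andP[_ pz]; rewrite inE => /orP[/eqP->//|].
  by move/(allP (order_path_min geq_trans pz)).
rewrite /conjp !oddparts_mkseq /= -(subnKC le_hx) PoszD big_split_ord /=.
set k := x - head 0 s.
rewrite [X in (_ + X)%R](_ : _ = k%:Z)%R; last first.
  rewrite (eq_bigr (fun=> 1%R)) ?sumr_const ?card_ord ?natz // => j _.
  rewrite ltn_add2l ltn_ord.
  rewrite (eq_in_count (a2 := pred0)) ?count_pred0 // => y /le_h /=; lia.
rewrite [X in (X + _)%R](_ : _ = \sum_(j < head 0%N s)
   (1 - (odd (count (fun y => (j < y)%N) s))%:Z))%R; last first.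
  apply: eq_bigr => j _.
  rewrite ltn_addr //.
  by rewrite oddD; case: (odd (count _ _)).
by rewrite sumrB sumr_const card_ord natz; ring.
Qed.

(** The alternating sum along a row of length l is 1 if l is odd and 0 otherwise,
    and likewise along a column: the two terms count odd rows and odd columns. *)
Lemma srank_cells s : is_part s ->
  (srank s = \sum_(c <- cells s) ((-1) ^+ c.2 - (-1) ^+ c.1) :> int)%R.
Proof.
move=> part_s; rewrite /srank sumrB; congr (_ - _)%R.
  elim: s {part_s} => [|x s IHs]; first by rewrite /cells big_nil.
  by rewrite big_cells_cons /= sum_sign PoszD IHs.
elim: s part_s => [|x s IHs] part_xs; first by rewrite /cells big_nil.
have part_s : is_part s.
  case/andP: part_xs => /= /path_sorted sorted_s.
  by rewrite /is_part sorted_s inE negb_or => /andP[].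
rewrite oddparts_conjp_cons // IHs // big_cells_cons /=.
rewrite sumr_const card_ord natz -sumrN; congr (_ + _)%R.
by apply: eq_bigr => c _; rewrite exprS mulN1r.
Qed.

(** * Bead sets *)

(** The tail has [size v'] entries, so this adds the staircase ..., 2, 1, 0 and makes
    a weakly decreasing sequence strictly decreasing. *)
Fixpoint beta (v : seq nat) : seq nat :=
  if v is x :: v' then x + size v' :: beta v' else [::].

Fixpoint unbeta (b : seq nat) : seq nat :=
  if b is p :: b' then p - size b' :: unbeta b' else [::].

Lemma size_beta v : size (beta v) = size v.
Proof. by elim: v => //= x v ->. Qed.

Lemma size_unbeta b : size (unbeta b) = size b.
Proof. by elim: b => //= x v ->. Qed.

Lemma betaK : cancel beta unbeta.
Proof. by elim=> //= x v ->; rewrite size_beta addnK. Qed.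

Lemma sorted_beta v : sorted geq v -> sorted gtn (beta v).
Proof.
elim: v => [|x [|y v] IHv] //= /andP[/= le_yx /IHv /= ->]; rewrite andbT; lia.
Qed.

Lemma size_le_head p b : sorted gtn (p :: b) -> size b <= p.
Proof.
elim: b p => //= q b IHb p /andP[/= lt_qp /IHb]; lia.
Qed.

Lemma unbetaK b : sorted gtn b -> beta (unbeta b) = b.
Proof.
elim: b => //= p b IHb sorted_b.
rewrite IHb ?(path_sorted sorted_b) // size_unbeta subnK //.
exact: size_le_head.
Qed.

Lemma sorted_unbeta b : sorted gtn b -> sorted geq (unbeta b).
Proof.
elim: b => [|p [|q b] IHb] //= /andP[/= lt_qp sorted_b].
apply/andP; split; last exact: IHb.
have /= := size_le_head sorted_b; lia.
Qed.

(** The cells of one row occupy consecutive positions, from the staircase entry of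
    the row up to just below its bead, so the sum telescopes row by row. *)
Lemma sum_beta (V : zmodType) (F : nat -> V) v :
  (\sum_(c <- cells v)
      (F (c.2 + (size v - c.1.+1)).+1 - F (c.2 + (size v - c.1.+1))%N)
   = \sum_(p <- beta v) F p - \sum_(m < size v) F m)%R.
Proof.
elim: v => [|x v IHv]; first by rewrite /cells !big_nil big_ord0 subr0.
rewrite big_cells_cons /= big_cons big_ord_recr /=.
under [X in (_ + X)%R]eq_bigr do rewrite subSS.
rewrite IHv; set n := size v; set A := (\sum_(p <- beta v) _)%R.
under eq_bigr do rewrite subSS subn0.
rewrite -(big_mkord xpredT (fun j => F (j + n).+1 - F (j + n)%N)%R).
rewrite (telescope_sumr (fun j => F (j + n)%N)) // opprD !addrA.
rewrite add0n [RHS]addrAC; congr (_ - _)%R; rewrite addrAC -!addrA; congr (_ + _)%R.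
Qed.

(** Listed in strictly decreasing order. All uses compare partitions through the
    same M, at least the number of parts. *)
Definition beads M s := beta (s ++ nseq (M - size s) 0).

Section Beads.
Variables (M : nat) (s : seq nat).
Hypotheses (part_s : is_part s) (le_sM : size s <= M).

Let pad_size : size (s ++ nseq (M - size s) 0) = M.
Proof. by rewrite size_cat size_nseq subnKC. Qed.

Lemma size_beads : size (beads M s) = M.
Proof. by rewrite size_beta pad_size. Qed.

Lemma sorted_beads : sorted gtn (beads M s).
Proof.
apply: sorted_beta; case/andP: part_s => + _.
have zero k x : path geq x (nseq k 0) by elim: k x => //= k IHk x; exact: IHk.
case: (s) => [|x s'] /=; last by rewrite cat_path => ->; exact: zero.
by move=> _; apply: path_sorted (zero _ 0).
Qed.

Lemma uniq_beads : uniq (beads M s).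
Proof. by have := sorted_beads; rewrite gtn_sorted_uniq_geq => /andP[]. Qed.

Lemma sum_beads (V : zmodType) (F : nat -> V) :
  (\sum_(c <- cells s)
      (F (c.2 + (M - c.1.+1)).+1 - F (c.2 + (M - c.1.+1))%N)
   = \sum_(p <- beads M s) F p - \sum_(m < M) F m)%R.
Proof. by have := sum_beta F (s ++ nseq (M - size s) 0); rewrite pad_size cells_pad. Qed.

(** The zero parts added as padding form an initial segment of beads. *)
Lemma small_beads m : m < M - size s -> m \in beads M s.
Proof.
rewrite /beads; elim: (s) {1 2}(M - size s) m => [|x s' IHs] k m /=.
  elim: k => //= k IHk; rewrite ltnS leq_eqVlt inE size_nseq => /orP[->//|/IHk->].
  by rewrite orbT.
by rewrite inE => /IHs ->; rewrite orbT.
Qed.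
End Beads.

Lemma beads_inj M s1 s2 : is_part s1 -> is_part s2 ->
  size s1 <= M -> size s2 <= M -> perm_eq (beads M s1) (beads M s2) -> s1 = s2.
Proof.
move=> part1 part2 le1 le2 eq12.
have gtn_trans : transitive gtn by move=> a b c /= ??; lia.
have gtn_anti : antisymmetric gtn by move=> a b /andP[/= ??]; lia.
have /(can_inj betaK) eq_pad : beads M s1 = beads M s2.
  exact: sorted_eq gtn_trans gtn_anti _ _ (sorted_beads _ part1) (sorted_beads _ part2) eq12.
have unpad s k : is_part s -> [seq x <- s ++ nseq k 0 | x != 0] = s.
  case/andP=> _ s0; rewrite filter_cat.
  have -> : [seq x <- nseq k 0 | x != 0] = [::] by elim: k.
  rewrite cats0; apply/all_filterP/allP => x xs.
  by apply: contraNneq s0 => <-.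
by rewrite -(unpad s1 (M - size s1)) // eq_pad unpad.
Qed.

(** The zeros of a weakly decreasing sequence are all at its end. *)
Lemma sorted_padE v : sorted geq v ->
  exists s, [/\ is_part s, size s <= size v & v = s ++ nseq (size v - size s) 0].
Proof.
elim: v => [|x v IHv] sorted_v; first by exists [::].
have [s [part_s le_s def_v]] := IHv (path_sorted sorted_v).
case: x sorted_v => [|x] sorted_v.
  exists [::]; split=> //=; congr (_ :: _).
  have: all (geq 0) v.
    by apply: order_path_min sorted_v => a b c /= ??; lia.
  by elim: (v) => //= y v' IHv' /andP[]; rewrite leqn0 => /eqP-> /IHv' <-.
exists (x.+1 :: s); split=> //=; last by rewrite subSS -def_v.
case/andP: part_s => _ s0; rewrite /is_part inE s0 andbT.
by move: sorted_v; rewrite def_v /= cat_path => /andP[].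
Qed.

Lemma beads_surj M b : uniq b -> size b = M ->
  exists s, [/\ is_part s, size s <= M & perm_eq (beads M s) b].
Proof.
move=> uniq_b size_b; pose t := sort geq b.
have sorted_t : sorted gtn t.
  rewrite gtn_sorted_uniq_geq sort_uniq uniq_b /=.
  by apply: sort_sorted => x y; exact: leq_total.
have size_t : size (unbeta t) = M by rewrite size_unbeta size_sort.
have [s [part_s le_s def_t]] := sorted_padE (sorted_unbeta sorted_t).
rewrite size_t in le_s def_t.
exists s; split=> //; rewrite /beads -def_t unbetaK //.
by apply/permPl; exact: perm_sort.
Qed.

Lemma sumn_beads M s : is_part s -> size s <= M ->
  ((sumn s)%:Z = \sum_(p <- beads M s) p%:Z - \sum_(m < M) m%:Z :> int)%R.
Proof.
move=> part_s le_s; rewrite -(sum_beads le_s Posz) -size_cells.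
rewrite (eq_bigr (fun=> 1%R)) => [|c _]; last by lia.
by rewrite big_const_seq count_predT iter_addr_0 natz.
Qed.

Lemma mem_cells_size s c : c \in cells s -> c.1 < size s.
Proof.
rewrite mem_cells => lt_c; rewrite ltnNge; apply: contraTN lt_c => ?.
by rewrite nth_default.
Qed.

(** With F the indicator of the class of i modulo 5, the difference F (x + 1) - F x
    is the contribution of a cell to r_i - r_(i+1): as 5 divides M, the content of
    the cell at position x is x + 1 modulo 5. *)
Lemma nvec_beads M s i : 10 %| M -> is_part s -> size s <= M -> i < 5 ->
  (nvec s i = \sum_(p <- beads M s) (p %% 5 == i)%N%:Z - (M %/ 5)%N%:Z)%R.
Proof.
move=> M10 part_s le_s lt_i.
have -> : ((M %/ 5)%N%:Z = \sum_(m < M) (m %% 5 == i)%N%:Z)%R.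
  rewrite -(divnK M10); elim: (M %/ 10) => [|q IHq]; first by rewrite big_ord0.
  rewrite mulSn addnC big_split_ord /= -IHq -[10 in RHS]/(2 * 5) mulnA.
  under eq_bigr do rewrite modnMDl.
  rewrite !big_ord_recl big_ord0 /=.
  have -> : ((q * 2 * 5 + 2 * 5) %/ 5 = q * 10 %/ 5 + 2) by lia.
  by move: lt_i; case: i {IHq} => [|[|[|[|[|?]]]]] //= _; lia.
rewrite -(sum_beads le_s (fun p => (p %% 5 == i)%N%:Z%R)) /nvec.
have rcountE j : ((rcount s j)%:Z =
    \sum_(c <- cells s) (((c.2%:Z - c.1%:Z) %% 5)%Z == j)%:Z :> int)%R.
  rewrite /rcount; elim: (cells s) => [|c l IHl]; first by rewrite big_nil.
  by rewrite big_cons -IHl.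
rewrite !rcountE -sumrB; apply: eq_big_seq => c /mem_cells_size lt_c.
have le_c : c.1.+1 <= M by lia.
have -> : (c.2%:Z - c.1%:Z = (c.2 + (M - c.1.+1)).+1%N%:Z - M%:Z)%R by lia.
move: (c.2 + _) => x.
have -> : ((x.+1%:Z - M%:Z) %% 5)%Z = ((x.+1 %% 5)%N : int) by lia.
congr (_ - _)%R; congr Posz; congr nat_of_bool; apply/eqP/eqP; lia.
Qed.

(** A cell in row i and column j contributes (-1)^j - (-1)^i to the rank, and
    1 - (-1)^(i+j) to the right-hand side: as M is even, the position of the cell
    has the parity of i + j + 1. The two values agree modulo 4 in all four parity
    cases. *)
Lemma srank_beads M s : 2 %| M -> is_part s -> size s <= M ->
  (4 %| srank s - ((sumn s)%:Z +
     (\sum_(p <- beads M s) (odd p)%:Z - \sum_(m < M) (odd m)%:Z)))%Z%R.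
Proof.
move=> M2 part_s le_s; rewrite -(sum_beads le_s (fun p => (odd p)%:Z%R)).
have -> : ((sumn s)%:Z = \sum_(c <- cells s) 1)%R.
  by rewrite big_const_seq count_predT iter_addr_0 natz size_cells.
rewrite srank_cells // -big_split -sumrB /= big_seq.
apply: rpred_sum => c /mem_cells_size lt_c.
rewrite -!(signr_odd _ c.1) -!(signr_odd _ c.2).
have -> : odd (c.2 + (M - c.1.+1)) = ~~ (odd c.2 (+) odd c.1) by lia.
by case: (odd c.1); case: (odd c.2).
Qed.

(** * Moving runners of the abacus *)

(** Runner i corresponds to the unordered pair of entries of alpha that add up to
    n_i + i modulo 2: runners 0, 1, 2, 3, 4 to the pairs {4,0}, {2,3}, {1,2}, {0,1},
    {3,4}. The permutation shifts these pairs by one place. *)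
Definition next_runner (i : nat) : nat := nth 0 [:: 3; 4; 1; 2; 0] i.

(** Runner [t i] is filled in rows 0 to [K i] - 1. *)
Definition ground (t K : nat -> nat) : seq nat :=
  [seq 5 * y + t i | i <- iota 0 5, y <- iota 0 (K i)].

Definition move_bead L (K : nat -> nat) p :=
  5 * (p %/ 5 - L + K (p %% 5)) + next_runner (p %% 5).

(** All positions below 5 L carry beads. Runner i is translated so that its first L
    rows become the first [K i] rows of runner [next_runner i]. Only the beads above
    are really moved, and the low part is refilled: this is what makes a downward
    translation possible with finitely many beads. *)
Definition twist L K (b : seq nat) :=
  ground next_runner K ++ [seq move_bead L K p | p <- b & 5 * L <= p].

Lemma next_runner_lt i : next_runner i < 5.
Proof. by case: i => [|[|[|[|[|[|i]]]]]]. Qed.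

Lemma next_runner_inj i j : i < 5 -> j < 5 -> next_runner i = next_runner j -> i = j.
Proof. by case: i j => [|[|[|[|[|i]]]]] [|[|[|[|[|j]]]]]. Qed.

Lemma move_bead_div L K p : move_bead L K p %/ 5 = p %/ 5 - L + K (p %% 5).
Proof. by rewrite /move_bead; have := next_runner_lt (p %% 5); lia. Qed.

Lemma move_bead_mod L K p : move_bead L K p %% 5 = next_runner (p %% 5).
Proof. by rewrite /move_bead; have := next_runner_lt (p %% 5); lia. Qed.

(** Below 5 L the truncated subtraction would identify rows. *)
Lemma move_bead_inj L K p q : 5 * L <= p -> 5 * L <= q ->
  move_bead L K p = move_bead L K q -> p = q.
Proof.
move=> le_p le_q eq_pq.
have eq_mod : p %% 5 = q %% 5.
  by apply: next_runner_inj; rewrite ?ltn_pmod // -!(move_bead_mod L K) eq_pq.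
by have := move_bead_div L K p; rewrite eq_pq move_bead_div eq_mod; lia.
Qed.

Lemma groundP t K q : reflect (exists i y, [/\ i < 5, y < K i & q = 5 * y + t i])
  (q \in ground t K).
Proof.
apply: (iffP allpairsPdep) => [] [i [y [lt_i lt_y ->]]]; exists i, y.
  by rewrite !mem_iota in lt_i lt_y.
by rewrite !mem_iota.
Qed.

Lemma uniq_ground t K : (forall i, i < 5 -> t i < 5) ->
  (forall i j, i < 5 -> j < 5 -> t i = t j -> i = j) -> uniq (ground t K).
Proof.
move=> lt_t inj_t; apply: allpairs_uniq_dep => [|i _|]; try exact: iota_uniq.
move=> [i y] [j z] /allpairsPdep[i1 [y1 [lt_i _ [-> _]]]].
case/allpairsPdep=> [j1 [z1 [lt_j _ [-> _]]]] /= eq_ij.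
move: lt_i lt_j; rewrite !mem_iota => /= lt_i lt_j.
have [ti tj] := (lt_t i1 lt_i, lt_t j1 lt_j).
have eq_i : i1 = j1 by apply: inj_t => //; lia.
by rewrite eq_i in eq_ij *; congr (Tagged _ _); lia.
Qed.

Lemma split_beads L b : uniq b -> (forall m, m < 5 * L -> m \in b) ->
  perm_eq b (ground id (fun=> L) ++ [seq p <- b | 5 * L <= p]).
Proof.
move=> uniq_b small_b.
have memg q : (q \in ground id (fun=> L)) = (q < 5 * L).
  apply/groundP/idP => [[i [y [lt_i lt_y ->]]]|lt_q]; first lia.
  by exists (q %% 5), (q %/ 5); split; lia.
apply: uniq_perm => //.
  rewrite cat_uniq filter_uniq // uniq_ground ?andbT //=.
  by apply/hasPn => q; rewrite mem_filter memg -leqNgt => /andP[].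
move=> q; rewrite mem_cat memg mem_filter.
by case: ltnP => //= /small_b.
Qed.

Lemma uniq_twist L K b : uniq b -> uniq (twist L K b).
Proof.
move=> uniq_b; rewrite cat_uniq; apply/and3P; split.
- by apply: uniq_ground => [i _|]; [exact: next_runner_lt | exact: next_runner_inj].
- apply/hasPn => q /mapP[p]; rewrite mem_filter => /andP[le_p _] -> {q}.
  apply/negP => /groundP[i [y [lt_i lt_y]]] eq_lift.
  have lt_r := next_runner_lt i.
  have eq_mod : next_runner (p %% 5) = next_runner i by rewrite -(move_bead_mod L K); lia.
  have eq_i : p %% 5 = i by apply: next_runner_inj => //; rewrite ltn_pmod.
  by have := move_bead_div L K p; rewrite eq_i; lia.
rewrite map_inj_in_uniq ?filter_uniq // => p q; rewrite !mem_filter.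
by move=> /andP[le_p _] /andP[le_q _]; exact: move_bead_inj.
Qed.

Lemma twist_inj L K b1 b2 : uniq b1 -> uniq b2 ->
  (forall m, m < 5 * L -> m \in b1) -> (forall m, m < 5 * L -> m \in b2) ->
  perm_eq (twist L K b1) (twist L K b2) -> perm_eq b1 b2.
Proof.
move=> u1 u2 small1 small2; rewrite perm_cat2l => eq12.
rewrite (permPl (split_beads u1 small1)) (permPr (split_beads u2 small2)).
rewrite perm_cat2l; apply: uniq_perm; rewrite ?filter_uniq //.
have half c1 c2 : perm_eq [seq move_bead L K p | p <- c1 & 5 * L <= p]
    [seq move_bead L K p | p <- c2 & 5 * L <= p] ->
    {subset [seq p <- c1 | 5 * L <= p] <= [seq p <- c2 | 5 * L <= p]}.
  move=> eq_c p p_c1; have := map_f (move_bead L K) p_c1.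
  rewrite (perm_mem eq_c) => /mapP[q q_c2 eq_pq].
  suff -> : p = q by [].
  move: p_c1 q_c2; rewrite !mem_filter => /andP[le_p _] /andP[le_q _].
  exact: move_bead_inj eq_pq.
by move=> p; apply/idP/idP; apply: half; rewrite // perm_sym.
Qed.

Lemma sum_ground (V : nmodType) t K (F : nat -> V) :
  (\sum_(p <- ground t K) F p
   = \sum_(i < 5) \sum_(y < K i) F (5 * y + t i)%N)%R.
Proof.
rewrite big_allpairs_dep -[iota 0 5]/(index_iota 0 5) big_mkord.
by apply: eq_bigr => i _; rewrite -{1}[K i]subn0 -/(index_iota _ _) big_mkord.
Qed.

Lemma sum_twist (V : nmodType) L K b (F : nat -> V) :
  (\sum_(p <- twist L K b) F p
   = \sum_(i < 5) \sum_(y < K i) F (5 * y + next_runner i)%N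
     + \sum_(p <- b | (5 * L <= p)%N) F (move_bead L K p))%R.
Proof. by rewrite big_cat big_map big_filter sum_ground. Qed.

Lemma sum_beads_split (V : nmodType) L b (F : nat -> V) :
  uniq b -> (forall m, m < 5 * L -> m \in b) ->
  (\sum_(p <- b) F p
   = \sum_(i < 5) \sum_(y < L) F (5 * y + i)%N
     + \sum_(p <- b | (5 * L <= p)%N) F p)%R.
Proof.
move=> uniq_b small_b.
by rewrite (perm_big _ (split_beads uniq_b small_b)) big_cat big_filter sum_ground.
Qed.

(** This reduces the displacement of the moved beads to the runner counts. *)
Lemma sum_runner (P : pred nat) b (f : nat -> int) :
  (\sum_(p <- b | P p) f (p %% 5)%N
   = \sum_(i < 5) (\sum_(p <- b | P p) (p %% 5 == i)%N%:Z) * f i)%R.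
Proof.
under [RHS]eq_bigr do rewrite big_distrl.
rewrite exchange_big; apply: eq_bigr => p _.
have lt_p : p %% 5 < 5 by rewrite ltn_pmod.
rewrite (bigD1 (Ordinal lt_p)) //= eqxx mul1r big1 ?addr0 // => i ne_i.
case: eqP => [eq_i|_]; last by rewrite mul0r.
by case/eqP: ne_i; apply/val_inj; rewrite /= eq_i.
Qed.

(** The two assumptions on K say that beads are only redistributed, and that the
    translation of each runner preserves the parity of positions. *)
Section Twist.
Variables (L : nat) (K : nat -> nat) (b : seq nat).
Hypotheses (uniq_b : uniq b) (small_b : forall m, m < 5 * L -> m \in b).
Hypothesis sumK : \sum_(i < 5) K i = 5 * L.
Hypothesis parK : forall i, i < 5 -> odd (K i + next_runner i) = odd (L + i).

Let cnt i : int := (\sum_(p <- b) (p %% 5 == i)%N%:Z)%R.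
Let high i : int := (\sum_(p <- b | (5 * L <= p)%N) (p %% 5 == i)%N%:Z)%R.

Lemma cnt_split i : i < 5 -> (cnt i = L%:Z + high i)%R.
Proof.
move=> lt_i; rewrite /cnt (sum_beads_split _ uniq_b small_b); congr (_ + _)%R.
rewrite (bigD1 (Ordinal lt_i)) //= [X in (_ + X)%R]big1 => [|j ne_ji].
  rewrite addr0 (eq_bigr (fun=> 1%R)) ?sumr_const ?card_ord ?natz // => y _.
  by rewrite mulnC modnMDl modn_small // eqxx.
apply: big1 => y _; case: eqP => // eq_i; case/eqP: ne_ji; apply: val_inj => /=.
have := ltn_ord j; lia.
Qed.

Lemma cnt_twist i : i < 5 ->
  (\sum_(p <- twist L K b) (p %% 5 == next_runner i)%N%:Z = (K i)%:Z - L%:Z + cnt i)%R.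
Proof.
move=> lt_i; rewrite cnt_split // addrA subrK sum_twist; congr (_ + _)%R.
  rewrite (bigD1 (Ordinal lt_i)) //= [X in (_ + X)%R]big1 => [|j ne_ji].
    rewrite addr0 (eq_bigr (fun=> 1%R)) ?sumr_const ?card_ord ?natz // => y _.
    by rewrite mulnC modnMDl modn_small ?next_runner_lt // eqxx.
  apply: big1 => y _; case: eqP => // eq_r; case/eqP: ne_ji; apply: val_inj.
  apply: next_runner_inj => //=; have := next_runner_lt j; lia.
apply: eq_bigr => p _; rewrite move_bead_mod; congr Posz; congr nat_of_bool.
by apply/eqP/eqP => [/next_runner_inj|->] //; apply; rewrite ?ltn_pmod.
Qed.

Lemma size_twist : size (twist L K b) = size b.
Proof.
rewrite -!sum1_size sum_twist [RHS](sum_beads_split _ uniq_b small_b); congr (_ + _).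
under eq_bigr do rewrite sum1_card card_ord.
by rewrite sumK; under eq_bigr do rewrite sum1_card card_ord; rewrite sum_nat_const card_ord.
Qed.

(** The moved beads keep their parity. In the filled part, twice the number of odd
    positions of runner c up to row m is m + [c odd] - [m + c odd], and each of these
    terms has the same sum before and after the move. *)
Lemma odd_twist :
  (\sum_(p <- twist L K b) (odd p)%:Z = \sum_(p <- b) (odd p)%:Z :> int)%R.
Proof.
rewrite sum_twist [RHS](sum_beads_split _ uniq_b small_b); congr (_ + _)%R; last first.
  apply: eq_bigr => p le_p; congr Posz; congr nat_of_bool.
  have := parK (ltn_pmod p (isT : 0 < 5)); rewrite /move_bead.
  by move: (K _) (next_runner _) => k r; lia.
have odds m c : ((\sum_(y < m) (odd (5 * y + c))%:Z) * 2
    = m%:Z + (odd c)%:Z - (odd (m + c))%:Z :> int)%R.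
  elim: m => [|m IHm]; first by rewrite big_ord0 add0n; lia.
  by rewrite big_ord_recr /= mulrDl IHm; lia.
apply: (mulIf (isT : (2 : int) != 0))%R; rewrite !mulr_suml.
under eq_bigr do rewrite odds.
under [RHS]eq_bigr do rewrite odds.
have sumKz : (\sum_(i < 5) (K i)%:Z = \sum_(i < 5) L%:Z :> int)%R.
  by rewrite -(big_morph Posz PoszD (erefl _)) sumK sumr_const card_ord; lia.
rewrite !sumrB !big_split /= sumKz; congr (_ + _ - _)%R.
  by rewrite !big_ord_recl !big_ord0.
by apply: eq_bigr => i _; rewrite parK.
Qed.

(** The doubled sums avoid halves in the arithmetic progressions of the filled part;
    the last term is twice the displacement of the beads above it. *)
Lemma sumn_twist :
  ((\sum_(p <- twist L K b) p%:Z) * 2 = (\sum_(p <- b) p%:Z) * 2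
   + \sum_(i < 5) (5 * (K i)%:Z * ((K i)%:Z - 1) + 2 * (next_runner i)%:Z * (K i)%:Z
        - 5 * L%:Z * (L%:Z - 1) - 2 * i%:Z * L%:Z
        + 2 * (cnt i - L%:Z) * (5 * ((K i)%:Z - L%:Z) + (next_runner i)%:Z - i%:Z)) :> int)%R.
Proof.
have sums m c : ((\sum_(y < m) (5 * y + c)%N%:Z) * 2
    = 5 * m%:Z * (m%:Z - 1) + 2 * c%:Z * m%:Z :> int)%R.
  elim: m => [|m IHm]; first by rewrite big_ord0; ring.
  by rewrite big_ord_recr /= mulrDl IHm; lia.
rewrite sum_twist (sum_beads_split _ uniq_b small_b).
pose e i : int := (5 * ((K i)%:Z - L%:Z) + (next_runner i)%:Z - i%:Z)%R.
have -> : (\sum_(p <- b | (5 * L <= p)%N) (move_bead L K p)%:Z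
   = \sum_(p <- b | (5 * L <= p)%N) p%:Z + \sum_(i < 5) high i * e i :> int)%R.
  rewrite -sum_runner -big_split; apply: eq_bigr => p le_p /=.
  rewrite /move_bead /e; move: (K _) (next_runner _) => k r; lia.
rewrite !mulrDl !mulr_suml.
under eq_bigr do rewrite sums.
under [X in (_ = X + _ + _)%R]eq_bigr do rewrite sums.
set S := (\sum_(p <- b | _) _)%R.
have -> : (\sum_(i < 5) high i * e i * 2
   = \sum_(i < 5) 2 * (cnt i - L%:Z) * e i :> int)%R.
  by apply: eq_bigr => i _; rewrite cnt_split //; ring.
rewrite [LHS]addrCA -[RHS]addrA [RHS]addrCA; congr (_ + _)%R.
rewrite -!big_split; apply: eq_bigr => i _; rewrite /e /=; ring.
Qed.
End Twist.

(** * The n-vector of the core *)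

Lemma cells_down s c d : is_part s -> c \in cells s ->
  d.1 <= c.1 -> d.2 <= c.2 -> d \in cells s.
Proof.
case/andP=> sorted_s _ c_s le1 le2.
have lt_c := mem_cells_size c_s.
rewrite mem_cells in c_s; rewrite mem_cells.
apply: leq_ltn_trans le2 (leq_trans c_s _).
have geq_trans : transitive geq by move=> x y z /= le_xy le_zx; apply: leq_trans le_xy.
apply: (sorted_leq_nth geq_trans leqnn 0 sorted_s) => //.
by rewrite inE (leq_ltn_trans le1).
Qed.

Definition content (c : nat * nat) : int := (c.2%:Z - c.1%:Z)%R.

(** If two distinct cells lie on one diagonal, the diagonal successor of the first
    is weakly above and to the left of the second, hence in the diagram, so the first
    is not on the rim. *)
Lemma rim_content_inj s : is_part s ->
  {in in_rim s &, injective content}.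
Proof.
move=> part_s c d.
wlog le_cd : c d / c.1 <= d.1.
  move=> wl c_rim d_rim eq_cd; case: (leqP c.1 d.1) => [le|/ltnW le].
    exact: wl.
  by apply/esym/wl.
move=> /andP[_ c_rim] /andP[d_s _]; rewrite /content => eq_cd.
case: (ltngtP c.1 d.1) le_cd => [lt_cd _||eq1 _] //; last first.
  by case: c d eq1 eq_cd {c_rim d_s} => [i j] [i' j'] /= -> eq_j; congr pair; lia.
by case/negP: c_rim; apply: (cells_down part_s d_s) => /=; lia.
Qed.

(** Adjacent cells have contents that differ by 1. A connected set of cells whose
    contents avoid the class of r modulo 5 thus never leaves an interval between two
    successive members of that class. *)
Lemma window_constant (D : seq (nat * nat)) (r : nat) : r < 5 ->
  connected_cells D -> {in D, forall c, (content c %% 5)%Z != r} ->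
  {in D &, forall c d, ((content c - r%:Z)%R %/ 5)%Z = ((content d - r%:Z)%R %/ 5)%Z}.
Proof.
move=> lt_r /forallP conn avoid c d c_D d_D.
have /forallP/(_ (SeqSub d_D))/connectP[p] := conn (SeqSub c_D).
rewrite -[c]/(val (SeqSub c_D)) -[d]/(val (SeqSub d_D)).
move: (SeqSub c_D) (SeqSub d_D) => {c_D d_D} {}c {}d.
elim: p c => [|e p IHp] c' /= => [_ ->//|/andP[adj path_p] def_d].
rewrite -(IHp e path_p def_d).
have := avoid _ (valP c'); have := avoid _ (valP e); move: adj; rewrite /= /adjacent /content.
move: (ssval c') (ssval e) => [i j] [i' j'] /=; lia.
Qed.

(** The five contents are distinct. If a class were missed, they would all lie in an
    interval of length 4; so each class is hit, hence exactly once. *)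
Lemma rim_hook_count s m i : is_part s -> rim_hook_removal 5 s m -> i < 5 ->
  count (fun c => (content c %% 5)%Z == i) (skew_cells s m) = 1.
Proof.
move=> part_s /and5P[_ _ /eqP size_D /allP rim_D conn_D].
set D := skew_cells s m in size_D rim_D conn_D *.
pose n j := count (fun c => (content c %% 5)%Z == j) D.
have uniq_D : uniq D by rewrite filter_uniq ?cells_uniq.
have hit j : j < 5 -> 0 < n j.
  move=> lt_j; rewrite -has_count; apply: contraT => /hasPn avoid.
  have window := window_constant lt_j conn_D avoid.
  pose f c := `|((content c - j%:Z)%R %% 5)%Z|%N.
  have inj_f : {in D &, injective f}.
    move=> c d c_D d_D eq_f; apply: (rim_content_inj part_s); try exact: rim_D.
    have := window c d c_D d_D; move: eq_f; rewrite /f.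
    by move: (content c) (content d) => x y; lia.
  have : size (map f D) <= size (iota 1 4).
    apply: uniq_leq_size; first by rewrite map_inj_in_uniq.
    move=> _ /mapP[c /avoid ne_j ->]; rewrite mem_iota /f.
    by move: (content c) ne_j => x; lia.
  by rewrite size_map size_D.
have sum_n : n 0 + n 1 + n 2 + n 3 + n 4 = 5.
  rewrite -size_D /n; elim: (D) => //= c l <-.
  have : (0 <= (content c %% 5)%Z)%R /\ ((content c %% 5)%Z < 5)%R by lia.
  by move: ((content c %% 5)%Z) => z; lia.
have := (hit 0 isT, hit 1 isT, hit 2 isT, hit 3 isT, hit 4 isT).
move=> [[[[]]]]; rewrite -/(n i).
by case: i => [|[|[|[|[|i]]]]] //=; lia.
Qed.

Lemma rim_hook_rcount s m i : is_part s -> rim_hook_removal 5 s m -> i < 5 ->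
  rcount s i = (rcount m i).+1.
Proof.
move=> part_s hook lt_i; rewrite -addn1 -(rim_hook_count part_s hook lt_i).
case/and5P: hook => _ /allP sub _ _ _.
rewrite /rcount -[RHS]count_cat; apply/permP.
apply: uniq_perm; rewrite ?cells_uniq //.
  rewrite cat_uniq cells_uniq filter_uniq ?cells_uniq // andbT.
  by apply/hasPn => c; rewrite mem_filter => /andP[].
move=> c; rewrite mem_cat mem_filter.
by case: (boolP (c \in cells m)) => //= c_m; exact: sub.
Qed.

(** Each removal lowers all five residue counts by one. *)
Lemma nvec_core s i : is_part s -> i < 5 -> nvec (core 5 s) i = nvec s i.
Proof.
move=> part_s lt_i; have [r [path_r <-]] := core_reachable 5 s.
elim: r s part_s path_r => //= m r IHr s part_s /andP[hook path_r].
have part_m : is_part m by case/andP: hook.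
rewrite IHr // /nvec (rim_hook_rcount part_s hook lt_i).
by rewrite (rim_hook_rcount part_s hook) ?ltn_pmod //; lia.
Qed.

(** * Rotating the vector alpha *)

(** The n-vector as a function of alpha. *)
Definition charge (a : seq int) (i : nat) : int :=
  (nth 0 [:: a`_0 + a`_4; - a`_0 + a`_1 + a`_4; - a`_1 + a`_2;
             - a`_2 + a`_3 - a`_4; - a`_3 - a`_4] i)%R.

(** The translation of runner i by n'_(next i) - n_i rows, in the form that [twist]
    expects. *)
Definition level L (a : seq int) (i : nat) : nat :=
  `|(L%:Z + charge (rotr 1 a) (next_runner i) - charge a i)%R|%N.

Lemma alpha_specP f (a : 5.-tuple int) :
  reflect ((a`_0 + a`_1 + a`_2 + a`_3 + a`_4 = 1)%R /\
           (forall i, i < 5 -> f i = charge a i))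
          (alpha_spec f a).
Proof.
apply: (iffP and5P) => [[/eqP sa /eqP e0 /eqP e1 /eqP e2 /andP[/eqP e3 /eqP e4]]|].
  by split=> // [[|[|[|[|[|i]]]]]].
by move=> [sa eq_f]; rewrite !eq_f // sa /charge /= !eqxx.
Qed.

(** The defining system for alpha is invertible, so a bound on the n-vector bounds
    the translations; 100 is a crude constant that makes every level nonnegative. *)
Lemma level_spec L N (a : 5.-tuple int) :
  (a`_0 + a`_1 + a`_2 + a`_3 + a`_4 = 1)%R ->
  (forall i, i < 5 -> (`|charge a i| <= N%:Z)%R) -> 100 * N.+1 <= L ->
  forall i, i < 5 ->
  ((level L a i)%:Z = L%:Z + charge (rotr 1 a) (next_runner i) - charge a i)%R.
Proof.
case: a => [[|a0 [|a1 [|a2 [|a3 [|a4 [|? ?]]]]]] //= sz] sum_a bound le_L i lt_i.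
have := (bound 0 isT, bound 1 isT, bound 2 isT, bound 3 isT, bound 4 isT).
rewrite /charge /= => [[[[[b0 b1] b2] b3] b4]].
rewrite /level; set x := (L%:Z + _ - _)%R.
suff : (0 <= x)%R by lia.
rewrite /x /charge /rotr /rot /=.
by case: i lt_i {x} => [|[|[|[|[|i]]]]] //= _; clear sz bound; lia.
Qed.

Lemma sum_charge (a : 5.-tuple int) : (\sum_(i < 5) charge a i = 0)%R.
Proof.
rewrite !big_ord_recl big_ord0 /= /charge /=; ring.
Qed.

Lemma sum_charge_rot (a : 5.-tuple int) :
  (\sum_(i < 5) charge (rotr 1 a) (next_runner i) = 0)%R.
Proof.
by rewrite !big_ord_recl big_ord0 /= /charge /=; ring.
Qed.

(** Each of the two terms is the sum of two adjacent entries of alpha modulo 2, once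
    1 is replaced by the sum of all entries; the two pairs coincide. *)
Lemma charge_parity (a : 5.-tuple int) i :
  (a`_0 + a`_1 + a`_2 + a`_3 + a`_4 = 1)%R -> i < 5 ->
  (2 %| charge (rotr 1 a) (next_runner i) + (next_runner i)%:Z - (charge a i + i%:Z))%Z%R.
Proof.
case: a => [[|a0 [|a1 [|a2 [|a3 [|a4 [|? ?]]]]]] //= sz] sum_a.
rewrite /charge /next_runner /rotr /rot /=.
by case: i => [|[|[|[|[|i]]]]] //= _; clear sz; lia.
Qed.

(** Twice the size of the 5-core with n-vector [charge a]. *)
Definition energy (a : seq int) : int :=
  (\sum_(i < 5) (5 * charge a i * charge a i + 2 * i%:Z * charge a i))%R.

(** Under the linear constraint this form equals
    10 (sum_i alpha_i^2 - sum_i alpha_i alpha_(i+1)) - 2, with cyclic indices, which is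
    visibly invariant under rotation. *)
Lemma energy_rot (a : 5.-tuple int) :
  (a`_0 + a`_1 + a`_2 + a`_3 + a`_4 = 1)%R -> energy (rotr 1 a) = energy a.
Proof.
case: a => [[|a0 [|a1 [|a2 [|a3 [|a4 [|? ?]]]]]] //= sz] sum_a.
have -> : (a0 = 1 - a1 - a2 - a3 - a4)%R by clear sz; lia.
by rewrite /energy !big_ord_recl !big_ord0 /= /bump /= /charge /rotr /rot /=; ring.
Qed.

Lemma energy_next_runner a : (energy a = \sum_(i < 5)
  (5 * charge a (next_runner i) * charge a (next_runner i)
   + 2 * (next_runner i)%:Z * charge a (next_runner i)))%R.
Proof.
rewrite /energy !big_ord_recl !big_ord0 /= /bump /next_runner /=.
by move: (charge a) => f; ring.
Qed.

(** M and L depend only on the size N, so that partitions of the same size can be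
    compared: M is a multiple of 10, M - N bounds 5 L from above, and L is large
    enough for [level_spec]. *)
Lemma twist_partition N s (a : 5.-tuple int) (M := 1000 * N.+1) (L := 100 * N.+1) :
  is_part s -> sumn s = N -> alpha_spec (nvec s) a ->
  exists s', [/\ is_part s' /\ sumn s' = N, (srank s' == srank s %[mod 4])%Z,
    alpha_spec (nvec s') [tuple of rotr 1 a] &
    perm_eq (beads M s') (twist L (level L a) (beads M s))].
Proof.
move=> part_s sum_s /alpha_specP[sum_a eq_n].
have le_s : size s <= N by rewrite -sum_s; apply: size_le_sumn; case/andP: part_s.
have le_sM : size s <= M by rewrite /M; lia.
have M10 : 10 %| M by rewrite /M -[1000]/(10 * 100) -mulnA dvdn_mulr.
have M2 : 2 %| M by apply: dvdn_trans M10.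
set b := beads M s.
have uniq_b : uniq b by exact: uniq_beads.
have small_b m : m < 5 * L -> m \in b.
  by move=> lt_m; apply: small_beads; move: lt_m; rewrite /M /L; lia.
have bound i : i < 5 -> (`|charge a i| <= N%:Z)%R.
  move=> lt_i; rewrite -eq_n // /nvec.
  have le_r j : rcount s j <= N by rewrite -sum_s -size_cells count_size.
  by have := le_r i; have := le_r (i.+1 %% 5); lia.
have levelE := level_spec sum_a bound (leqnn L).
pose K := level L a; rewrite -/K in levelE *.
have cntE i : i < 5 -> (\sum_(p <- b) (p %% 5 == i)%N%:Z
    = charge a i + (M %/ 5)%N%:Z)%R.
  by move=> lt_i; rewrite -eq_n // (nvec_beads M10) // subrK.
have sumK : \sum_(i < 5) K i = 5 * L.
  suff : ((\sum_(i < 5) K i)%N%:Z = (5 * L)%N%:Z)%R by case.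
  rewrite (big_morph Posz PoszD (erefl _)).
  rewrite (eq_bigr (fun i : 'I_5 =>
    L%:Z + charge (rotr 1 a) (next_runner i) - charge a i)%R) => [|i _]; last exact: levelE.
  rewrite sumrB big_split /= sum_charge sum_charge_rot sumr_const card_ord; lia.
have parK i : i < 5 -> odd (K i + next_runner i) = odd (L + i).
  by move=> lt_i; have := charge_parity sum_a lt_i; have := levelE i lt_i; lia.
set tw := twist L K b.
have size_tw : size tw = M by rewrite size_twist // size_beads.
have [s' [part_s' le_s' eq_tw]] := beads_surj (uniq_twist L K uniq_b) size_tw.
have sum_tw : (\sum_(p <- tw) p%:Z = \sum_(p <- b) p%:Z :> int)%R.
  apply: (mulIf (isT : (2 : int) != 0))%R.
  rewrite sumn_twist // -[RHS]addr0; congr (_ + _)%R.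
  set T := Posz (M %/ 5) in cntE.
  (* Besides the quadratic part, the variation is linear in the translations and in
     next i - i, and both have zero sum. *)
  transitivity (energy (rotr 1 a) - energy a + ((10 * T - 5) *
      (\sum_(i < 5) charge (rotr 1 a) (next_runner i) - \sum_(i < 5) charge a i)
    + 2 * T * (\sum_(i < 5) ((next_runner i)%:Z - i%:Z))))%R.
    rewrite energy_next_runner -!sumrB !mulr_sumr -!big_split; apply: eq_bigr => i _.
    by rewrite cntE // levelE //=; ring.
  rewrite energy_rot // sum_charge sum_charge_rot !subrr mulr0 !add0r.
  by rewrite !big_ord_recl big_ord0 mulr0.
have sum_s' : sumn s' = N.
  apply/eqP; rewrite -eqz_nat -sum_s (sumn_beads part_s' le_s').
  by rewrite (sumn_beads part_s le_sM) (perm_big _ eq_tw) sum_tw.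
exists s'; split=> //.
  have := srank_beads M2 part_s' le_s'; have := srank_beads M2 part_s le_sM.
  rewrite (perm_big _ eq_tw) odd_twist // sum_s sum_s' -/b.
  set x := (_ + _)%R; lia.
apply/alpha_specP; split.
  case: (a) sum_a => [[|a0 [|a1 [|a2 [|a3 [|a4 [|? ?]]]]]] //= sz] sum_a.
  by rewrite -sum_a; ring.
have step i : i < 5 -> (nvec s' (next_runner i) = charge (rotr 1 a) (next_runner i))%R.
  move=> lt_i; rewrite (nvec_beads M10) ?next_runner_lt // (perm_big _ eq_tw).
  by rewrite cnt_twist // levelE // cntE //; ring.
move=> i lt_i.
have : exists2 j, j < 5 & i = next_runner j.
  by case: i lt_i => [|[|[|[|[|i]]]]] // _; [exists 4|exists 2|exists 3|exists 0|exists 1].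
by case=> j lt_j ->; exact: step.
Qed.

(** Moving the last entry to the front raises the other indices by 1, and lowers the
    last one from 4 to 0, which is again 1 modulo 5. *)
Lemma c5_rot n (p q : intpartn (5 * n + 4)) :
  alpha q = [tuple of rotr 1 (alpha p)] -> (c5 q = c5 p + 1 %[mod 5])%Z.
Proof.
move=> eq_q; rewrite /c5 eq_q.
have := xchooseP (alpha_exists p); rewrite -/(alpha p) => /alpha_specP[sum_a _].
move: (alpha p) sum_a => [[|a0 [|a1 [|a2 [|a3 [|a4 [|? ?]]]]]] //= sz] sum_a.
rewrite !big_ord_recl !big_ord0 /= /bump /=.
clear sz; lia.
Qed.

Lemma alpha_spec_core s (a : 5.-tuple int) : is_part s ->
  alpha_spec (nvec (core 5 s)) a = alpha_spec (nvec s) a.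
Proof.
move=> part_s; apply/alpha_specP/alpha_specP => -[sum_a eq_n]; split=> // i lt_i.
  by rewrite -nvec_core // eq_n.
by rewrite nvec_core // eq_n.
Qed.

Lemma rotate_exists n (p : intpartn (5 * n + 4)) (N := 5 * n + 4) :
  exists q : intpartn (5 * n + 4), [&& (srank q == srank p %[mod 4])%Z,
    alpha q == [tuple of rotr 1 (alpha p)] &
    perm_eq (beads (1000 * N.+1) q)
      (twist (100 * N.+1) (level (100 * N.+1) (alpha p)) (beads (1000 * N.+1) p))].
Proof.
have /andP[part_p /eqP sum_p] := pvalP p.
have := xchooseP (alpha_exists p); rewrite -/(alpha p) alpha_spec_core // => spec_p.
have [s [[part_s sum_s] rank_s spec_s beads_s]] := twist_partition part_p sum_p spec_p.
have sP : is_part_of (5 * n + 4) s by rewrite /is_part_of part_s sum_s eqxx.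
exists (IntPartn sP); rewrite rank_s beads_s andbT /=.
apply/eqP; apply: (@alpha_unique (nvec (core 5 s))); last by rewrite alpha_spec_core.
exact: xchooseP (alpha_exists (IntPartn sP)).
Qed.

(** * Equidistribution *)

Definition rotate n (p : intpartn (5 * n + 4)) : intpartn (5 * n + 4) :=
  xchoose (rotate_exists p).

(** The image determines the rotated vector alpha, hence alpha and all the
    translations, and these can be undone on the beads. *)
Lemma rotate_inj n : injective (@rotate n).
Proof.
move=> p q eq_pq.
have /and3P[_ /eqP alpha_p beads_p] := xchooseP (rotate_exists p).
have /and3P[_ /eqP alpha_q beads_q] := xchooseP (rotate_exists q).
rewrite -/(rotate p) in alpha_p beads_p; rewrite -/(rotate q) -eq_pq in alpha_q beads_q.
have eq_alpha : alpha p = alpha q.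
  apply: val_inj; apply: (can_inj (rotrK 1)).
  by move: alpha_p; rewrite alpha_q => /(congr1 val) /= ->.
rewrite -eq_alpha (permPl beads_p) in beads_q.
have /andP[part_p /eqP sum_p] := pvalP p.
have /andP[part_q /eqP sum_q] := pvalP q.
have size_le s : is_part s -> sumn s = 5 * n + 4 -> size s <= 5 * n + 4.
  by move=> /andP[_ s0] <-; exact: size_le_sumn.
have [le_p le_q] := (size_le _ part_p sum_p, size_le _ part_q sum_q).
apply: val_inj; apply: (beads_inj part_p part_q _ _ (twist_inj _ _ _ _ beads_q)).
- lia.
- lia.
- exact: uniq_beads part_p.
- exact: uniq_beads part_q.
- move=> m lt_m; apply: small_beads; lia.
- move=> m lt_m; apply: small_beads; lia.
Qed.

Definition crank_class n (i k : nat) : {set intpartn (5 * n + 4)} :=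
  [set p : intpartn (5 * n + 4) |
    (srank p == i %[mod 4])%Z && (c5 p == k %[mod 5])%Z].

Lemma card_crank_class_le n i k :
  #|crank_class n i k| <= #|crank_class n i k.+1|.
Proof.
rewrite -(card_imset _ (@rotate_inj n)); apply/subset_leq_card/subsetP => q /imsetP[p].
rewrite inE => /andP[rank_p crank_p] -> {q}; rewrite inE.
have /and3P[rank_q /eqP/c5_rot crank_q _] := xchooseP (rotate_exists p).
rewrite -/(rotate p) in rank_q crank_q *; apply/andP; split; lia.
Qed.

(** The inequalities between successive classes close up after five steps. *)
Lemma card_crank_class n i k l : #|crank_class n i k| = #|crank_class n i l|.
Proof.
have le a d : #|crank_class n i a| <= #|crank_class n i (a + d)|.
  elim: d => [|d IHd]; first by rewrite (addn0 a).
  by rewrite (addnS a d) (leq_trans IHd) ?card_crank_class_le.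
have period a d : crank_class n i (a + 5 * d) = crank_class n i a.
  apply/setP => p; rewrite !inE; congr (_ && _); lia.
have half a b : #|crank_class n i a| <= #|crank_class n i b|.
  rewrite -(period b a); have -> : b + 5 * a = a + (b + 4 * a) by lia.
  exact: le.
by apply/eqP; rewrite eqn_leq !half.
Qed.

Theorem theorem4p1 (n i : nat) (hi : i \in [:: 0; 2]) (k : 'I_5) :
  (#|[set p : intpartn (5 * n + 4) |
       (srank p == i %[mod 4])%Z && (c5 p == k %[mod 5])%Z]|%:R
   = 5^-1 * (p_ i (5 * n + 4))%:R :> rat)%R.
Proof.
suff -> : p_ i (5 * n + 4) = 5 * #|crank_class n i k|.
  by rewrite natrM mulrA mulVf ?mul1r.
transitivity (\sum_(l < 5) #|crank_class n i l|).
  rewrite /p_ -sum1_card (eq_bigl (fun p : intpartn (5 * n + 4) =>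
    (srank p == i %[mod 4])%Z)) => [|p]; last by rewrite inE.
  (* The residue is below 5, so that the default value of inord is never met. *)
  rewrite (partition_big (fun p => inord `|(c5 p %% 5)%Z|%N : 'I_5) xpredT) //=.
  apply: eq_bigr => l _; rewrite -sum1_card; apply: eq_bigl => p; rewrite inE.
  congr (_ && _); rewrite -val_eqE /= inordK; have := ltn_ord l; lia.
rewrite (eq_bigr (fun=> #|crank_class n i k|)) => [|l _]; last exact: card_crank_class.
by rewrite sum_nat_const card_ord.
Qed.
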